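(* Let $\lambda\in(0,1)$ and $T\in\mathbb{B}(\mathcal{H})$. Then the following conditions are equivalent: (i) $\|P_{\lambda}(T)\|=2(1-2\lambda+2\lambda^2)\Big\|M_{\frac{(1-\lambda)^2}{(1-\lambda)^2+\lambda^2}}(T)\Big\|$. (ii) $\dfrac{1-2\lambda+2\lambda^2}{2\lambda-2\lambda^2}\Big\|M_{\frac{(1-\lambda)^2}{(1-\lambda)^2+\lambda^2}}(T)\Big\|^2\in\overline{W\Big(\big(M_{\frac{(1-\lambda)^2}{(1-\lambda)^2+\lambda^2}}(T)\big)^{*}\Delta(T)\Big)}$. In particular, $\|P(T)\|=\|M(T)\|$ if and only if $\|M(T)\|^2\in\overline{W\big((M(T))^{*}\Delta(T)\big)}$.
   Context: $\mathbb{B}(\mathcal{H})$ denotes the bounded linear operators on a nonzero complex Hilbert space $\mathcal{H}$. $W(S)=\{\langle Sx,x\rangle:\|x\|=1\}$ is the numerical range of $S$, and the bar denotes closure in $\mathbb{C}$. Every $T\in\mathbb{B}(\mathcal{H})$ has a unique polar decomposition $T=U|T|$, where $|T|=(T^{*}T)^{1/2}$ and $U$ is a partial isometry with $\mathcal{N}(U)=\mathcal{N}(T)$. The Duggal transform is $T^{D}=|T|U$, the Aluthge transform is $\Delta(T)=|T|^{1/2}U|T|^{1/2}$, for $t\in[0,1]$ the weighted mean transform is $M_{t}(T)=tT+(1-t)T^{D}$, and for $\lambda\in[0,1]$ the power mean transform is $P_{\lambda}(T)=(1-\lambda)^2T+\lambda^2T^{D}+2\lambda(1-\lambda)\Delta(T)$.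 Also $M(T)=M_{1/2}(T)=\frac12T+\frac12T^{D}$ and $P(T)=P_{1/2}(T)=\frac12M(T)+\frac12\Delta(T)$. *)

(* Defs.v *)
From HB Require Import structures.
From mathcomp Require Import all_boot all_order all_algebra.
From mathcomp Require Import sesquilinear.
From mathcomp Require Import complex.
From mathcomp Require Import all_classical all_reals all_analysis.

Set Implicit Arguments.
Unset Strict Implicit.
Unset Printing Implicit Defensive.

Import Order.TTheory GRing.Theory Num.Theory.
Import numFieldNormedType.Exports.

Local Open Scope classical_set_scope.
Local Open Scope ring_scope.
Local Open Scope complex_scope.

(** A complex Hilbert space is a complete normed [R[i]]-module whose norm is
    induced by a positive definite Hermitian form.  By the convention of
    [{dot _ for _}], the form is linear in its first argument and
    conjugate-linear in the second one. *)
HB.mixin Record isHilbert (R : realType) H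
    of CompleteNormedModule R[i] H := {
  inner : {dot H for (@Num.conj R[i])} ;
  inner_norm : forall x : H, inner x x = `|x| ^+ 2
}.

#[short(type="hilbertType")]
HB.structure Definition Hilbert (R : realType) :=
  {H of CompleteNormedModule R[i] H & isHilbert R H}.

Section Operators.
Context {R : realType} {H : hilbertType R}.
Implicit Types S T A U : H -> H.

(** Membership in B(H); operators are carried as plain functions, with the
    pointwise linear structure on [H -> H] and with [\o] as product. *)
Definition bounded_operator T : Prop :=
  linear T /\ bounded_near T (nbhs (0 : H)).

(** The norm of [H] takes its values in the nonnegative reals of [R[i]],
    hence [complex.Re], which makes the operator norm a real number. *)
Definition opnorm T : R :=
  sup [set complex.Re `|T x| | x in [set x : H | `|x| <= 1]].

(** The objects selected below by [xget] exist and are unique, for bounded [T]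
    in [adjoint] and [polar_factor] and for positive [A] in [opsqrt]; the
    default value [0] plays no role in these cases. *)
Definition adjoint T : H -> H :=
  xget 0 [set S | bounded_operator S /\
                  forall x y, inner (T x) y = inner x (S y)].

(** In the order of [R[i]], [0 <= z] means that [z] is real and nonnegative. *)
Definition positive_operator A : Prop :=
  bounded_operator A /\ forall x, 0 <= inner (A x) x.

Definition opsqrt A : H -> H :=
  xget 0 [set S | positive_operator S /\ S \o S = A].

Definition opabs T : H -> H := opsqrt (adjoint T \o T).

Definition nullspace T : set H := [set x | T x = 0].

Definition orthogonal_complement (E : set H) : set H :=
  [set x | forall y, E y -> inner x y = 0].

Definition partial_isometry U : Prop :=
  bounded_operator U /\
  forall x, orthogonal_complement (nullspace U) x -> `|U x| = `|x|.

Definition polar_factor T : H -> H :=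
  xget 0 [set U | [/\ partial_isometry U, T = U \o opabs T &
                    nullspace U = nullspace T]].

Definition duggal T : H -> H := opabs T \o polar_factor T.

Definition aluthge T : H -> H :=
  opsqrt (opabs T) \o polar_factor T \o opsqrt (opabs T).

Definition weighted_mean (t : R) T : H -> H :=
  t%:C *: T + (1 - t)%:C *: duggal T.

Definition power_mean (l : R) T : H -> H :=
  ((1 - l) ^+ 2)%:C *: T + (l ^+ 2)%:C *: duggal T
    + (2 * l * (1 - l))%:C *: aluthge T.

Definition mean_transform T : H -> H := weighted_mean (1 / 2) T.

Definition power_mean_transform T : H -> H := power_mean (1 / 2) T.

Definition numerical_range S : set R[i]^o :=
  [set inner (S x) x | x in [set x : H | `|x| = 1]].

End Operators.

(* Main.v *)
Require Import Defs.
From HB Require Import structures.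
From mathcomp Require Import all_boot all_order all_algebra.
From mathcomp Require Import sesquilinear.
From mathcomp Require Import complex.
From mathcomp Require Import all_classical all_reals all_analysis.
From mathcomp Require Import ring lra.

(** With [s = (1 - l)^2 + l^2] and [r = 2 l (1 - l)] the power mean is
    [s M + r Delta].  Applying the Heinz inequality
    [2 |A X B| <= |A A X + X B B|] to [A = l |T|^(1/2)],
    [B = (1 - l) |T|^(1/2)] and [X = U] gives [r |Delta| <= s |M|], so that
    [2 s |M|] is the largest possible norm of the sum.  It is attained exactly
    when some unit vectors [x] make [<r Delta x, s M x>] tend to [s^2 |M|^2]:
    expand [|s M x + r Delta x|^2] in one direction, and use
    [|a + b|^2 >= 4 Re <a, b>] in the other. *)

Set Implicit Arguments.
Unset Strict Implicit.
Unset Printing Implicit Defensive.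

Import Order.TTheory GRing.Theory Num.Theory.
Import numFieldNormedType.Exports.

Local Open Scope classical_set_scope.
Local Open Scope ring_scope.
Local Open Scope complex_scope.

(** * The underlying real inner product and the Cauchy-Schwarz inequality *)

Section InnerProduct.
Context {R : realType} {H : hilbertType R}.
Implicit Types (x y z : H) (a : R).

(** The norm of [H] lives in [R[i]]; its value in [R] is what ordered-field reasoning such as [lra]
    can handle. *)
Definition rnorm x : R := complex.Re `|x|.

(** The inner product of [H] regarded as a real Hilbert space. *)
Definition rinner x y : R := complex.Re (inner x y).

Lemma Re_addc (u v : R[i]) : complex.Re (u + v) = complex.Re u + complex.Re v.
Proof. by case: u => a b; case: v. Qed.

Lemma rnormE x : `|x| = (rnorm x)%:C.
Proof. by rewrite /rnorm RRe_real // normr_real. Qed.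

Lemma rnorm_ge0 x : 0 <= rnorm x.
Proof. by rewrite -ler0c -rnormE. Qed.

Lemma rnorm0 : rnorm (0 : H) = 0.
Proof. by rewrite /rnorm normr0. Qed.

Lemma rnorm_eq0 x : rnorm x = 0 -> x = 0.
Proof. by move=> x0; apply: normr0_eq0; rewrite rnormE x0. Qed.

Lemma rnormD x y : rnorm (x + y) <= rnorm x + rnorm y.
Proof. by rewrite -lecR rmorphD /= -!rnormE ler_normD. Qed.

Lemma rnormZ a x : 0 <= a -> rnorm (a%:C *: x) = a * rnorm x.
Proof.
move=> a0; apply: complexI; rewrite rmorphM /= -!rnormE normrZ; congr (_ * _).
by rewrite ger0_norm // ler0c.
Qed.

Lemma innerDl x y z : inner (x + y) z = inner x z + inner y z.
Proof. exact: linearDl. Qed.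

Lemma innerZl (c : R[i]) x y : inner (c *: x) y = c * inner x y.
Proof. exact: linearZl. Qed.

Lemma innerC x y : inner x y = (inner y x)^*.
Proof. by rewrite hermC expr0 mul1r. Qed.

Lemma innerZr (c : R[i]) x y : inner x (c *: y) = c^* * inner x y.
Proof. by rewrite innerC innerZl rmorphM /= -innerC. Qed.

Lemma innerDr x y z : inner z (x + y) = inner z x + inner z y.
Proof. by rewrite innerC innerDl rmorphD /= -!innerC. Qed.

Lemma rinnerC x y : rinner x y = rinner y x.
Proof. by rewrite /rinner innerC; case: (inner y x). Qed.

Lemma rinnerDl x y z : rinner (x + y) z = rinner x z + rinner y z.
Proof. by rewrite /rinner innerDl Re_addc. Qed.

Lemma rinnerDr x y z : rinner z (x + y) = rinner z x + rinner z y.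
Proof. by rewrite ![rinner z _]rinnerC rinnerDl. Qed.

Lemma rinnerZl a x y : rinner (a%:C *: x) y = a * rinner x y.
Proof.
by rewrite /rinner innerZl; case: (inner x y) => b c /=; rewrite mul0r subr0.
Qed.

Lemma rinnerZr a x y : rinner x (a%:C *: y) = a * rinner x y.
Proof. by rewrite rinnerC rinnerZl rinnerC. Qed.

Lemma rinnerNl x y : rinner (- x) y = - rinner x y.
Proof. by rewrite -scaleN1r -(rmorphN1 (real_complex R)) rinnerZl mulN1r. Qed.

Lemma rinnerNr x y : rinner x (- y) = - rinner x y.
Proof. by rewrite rinnerC rinnerNl rinnerC. Qed.

Lemma rinnerii x y : rinner ('i *: x) ('i *: y) = rinner x y.
Proof.
rewrite /rinner innerZl innerZr; case: (inner x y) => b c /=.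
by rewrite !(mul0r, mul1r, mulr0, add0r, subr0, addr0, oppr0, opprK, mulN1r, sub0r).
Qed.

(** Lets identities proved for the real form be lifted to the complex one. *)
Lemma innerE x y : inner x y = (rinner x y) +i* (rinner x ('i *: y)).
Proof.
rewrite /rinner innerZr; case: (inner x y) => b c /=.
by rewrite !(mul0r, mul1r, sub0r, mulN1r, opprK).
Qed.

Lemma rinnerxx x : rinner x x = rnorm x ^+ 2.
Proof. by rewrite /rinner inner_norm rnormE -rmorphXn. Qed.

Lemma rnormD2 x y :
  rnorm (x + y) ^+ 2 = rnorm x ^+ 2 + rnorm y ^+ 2 + 2 * rinner x y.
Proof. by rewrite -!rinnerxx rinnerDl !rinnerDr (rinnerC y x); ring. Qed.

Lemma rnormN x : rnorm (- x) = rnorm x.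
Proof. by rewrite /rnorm normrN. Qed.

Lemma rnormB2 x y :
  rnorm (x - y) ^+ 2 = rnorm x ^+ 2 + rnorm y ^+ 2 - 2 * rinner x y.
Proof. by rewrite rnormD2 rnormN rinnerNr; ring. Qed.

(** Expanding the square of the norm of |y| x - |x| y gives 2 |x| |y| (|x| |y| - Re <x, y>) >= 0;
    vanishing norms are treated apart so that |x| |y| can be cancelled. *)
Lemma rinner_le x y : rinner x y <= rnorm x * rnorm y.
Proof.
have x0 := rnorm_ge0 x; have y0 := rnorm_ge0 y.
have : 0 <= rnorm ((rnorm y)%:C *: x - (rnorm x)%:C *: y) ^+ 2 by exact: sqr_ge0.
rewrite rnormB2 !rnormZ // rinnerZl rinnerZr => h.
have [x00|xn] := eqVneq (rnorm x) 0.
  by rewrite x00 (rnorm_eq0 x00) -(scale0r 0) -[0 in X in X *: _]/(0%:C) rinnerZl !mul0r.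
have [y00|yn] := eqVneq (rnorm y) 0.
  by rewrite y00 (rnorm_eq0 y00) -(scale0r 0) -[0 in X in X *: _]/(0%:C) rinnerZr !mul0r mulr0.
have xp : 0 < rnorm x by rewrite lt_neqAle eq_sym xn.
have yp : 0 < rnorm y by rewrite lt_neqAle eq_sym yn.
rewrite -(ler_pM2l (mulr_gt0 xp yp)); lra.
Qed.

(** With w = <x, y>, replacing x by its multiple by the conjugate of w makes the inner product the
    real number |w|^2, so the real inequality applies and |w| cancels. *)
Lemma inner_le x y : `|inner x y| <= (rnorm x * rnorm y)%:C.
Proof.
set w := inner x y.
have [->|w0] := eqVneq w 0.
  by rewrite normr0 ler0c mulr_ge0 // rnorm_ge0.
have nw : `|w| = (complex.Re `|w|)%:C by rewrite RRe_real // normr_real.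
have nw0 : 0 < complex.Re `|w| by rewrite -ltcR -nw normr_gt0.
have := rinner_le (w^* *: x) y.
rewrite /rinner innerZl -/w mulrC -[w * _]/(w * Num.conj w) -normCK nw -rmorphXn /=.
have -> : rnorm (w^* *: x) = complex.Re `|w| * rnorm x.
  rewrite /rnorm normrZ -[`|w^*|]/(`|Num.conj w|) norm_conjC {1}nw rnormE -rmorphM.
  by [].
by rewrite expr2 -mulrA ler_pM2l // lecR.
Qed.

End InnerProduct.

(** * Norm bounds, closure properties, and symmetry of positive operators *)

Section BoundedOperators.
Context {R : realType} {H : hilbertType R}.
Implicit Types (S T A B : H -> H) (x y : H).

Lemma bounded_operatorP T :
  bounded_operator T <->
  linear T /\ exists2 C : R, 0 <= C & forall x, rnorm (T x) <= C * rnorm x.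
Proof.
split=> -[linT bT]; split=> //.
  pose fT := GRing.isLinear.Build R[i] H H *:%R T linT.
  pose F : {linear H -> H} := HB.pack T fT.
  have /(linear_boundedP F)[M [Mreal hM]] := bT.
  have /complex_realP[m Mm] := Mreal.
  (* The bound is available only for constants strictly above [m], hence [m + 1]; the absolute value
     makes it nonnegative. *)
  exists `|m + 1| => [|x]; first exact: normr_ge0.
  have : M < (`|m + 1|)%:C.
    by rewrite Mm ltcR (lt_le_trans _ (ler_norm _)) // ltrDl.
  by move=> /hM/(_ x); rewrite !rnormE -rmorphM lecR.
have [C C0 hC] := bT.
pose fT := GRing.isLinear.Build R[i] H H *:%R T linT.
pose F : {linear H -> H} := HB.pack T fT.
apply/(linear_boundedP F); exists C%:C; split.
  by apply/complex_realP; exists C.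
move=> M CM x; rewrite (le_trans (y := C%:C * `|x|)) //.
  by rewrite !rnormE -rmorphM lecR; exact: hC.
by rewrite ler_wpM2r // ltW.
Qed.

Lemma bounded_bound T : bounded_operator T ->
  exists2 C : R, 0 < C & forall x, rnorm (T x) <= C * rnorm x.
Proof.
move=> /bounded_operatorP[_ [C C0 hC]]; exists (C + 1) => [|x].
  by rewrite ltr_wpDl.
by rewrite (le_trans (hC x)) // ler_wpM2r ?rnorm_ge0 // lerDl.
Qed.

Lemma bopD T x y : bounded_operator T -> T (x + y) = T x + T y.
Proof. by case=> /(_ 1 x y); rewrite !scale1r. Qed.

Lemma bop0 T : bounded_operator T -> T 0 = 0.
Proof. by move=> bT; apply: (addIr (T 0)); rewrite add0r -bopD // addr0. Qed.

Lemma bopZ T c x : bounded_operator T -> T (c *: x) = c *: T x.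
Proof. by move=> bT; case: (bT) => /(_ c x 0) + _; rewrite (bop0 bT) !addr0. Qed.

Lemma addfunE S T x : (S + T) x = S x + T x.
Proof. by []. Qed.

Lemma scalefunE (c : R[i]) T x : (c *: T) x = c *: T x.
Proof. by []. Qed.

Lemma bounded_zero : bounded_operator (0 : H -> H).
Proof.
apply/bounded_operatorP; split=> [c x y|]; first by rewrite /= scaler0 addr0.
by exists 0 => // x; rewrite rnorm0 mul0r.
Qed.

Lemma bounded_comp S T :
  bounded_operator S -> bounded_operator T -> bounded_operator (S \o T).
Proof.
move=> bS bT; have [C C0 hC] := bounded_bound bS.
have [D D0 hD] := bounded_bound bT.
apply/bounded_operatorP; split=> [c x y|].
  by rewrite /= bopD // bopZ // bopD // bopZ.
exists (C * D) => [|x]; first by rewrite mulr_ge0 // ltW.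
by rewrite (le_trans (hC _)) // -mulrA ler_pM2l.
Qed.

Lemma bounded_add S T :
  bounded_operator S -> bounded_operator T -> bounded_operator (S + T).
Proof.
move=> bS bT; have [C C0 hC] := bounded_bound bS.
have [D D0 hD] := bounded_bound bT.
apply/bounded_operatorP; split=> [c x y|].
  rewrite !addfunE (bopD _ _ bS) (bopD _ _ bT) (bopZ _ _ bS) (bopZ _ _ bT).
  by rewrite scalerDr addrACA.
exists (C + D) => [|x]; first by rewrite addr_ge0 // ltW.
by rewrite addfunE (le_trans (rnormD _ _)) // mulrDl lerD.
Qed.

Lemma bounded_scale (c : R[i]) T : bounded_operator T -> bounded_operator (c *: T).
Proof.
move=> bT; have [C C0 hC] := bounded_bound bT.
apply/bounded_operatorP; split=> [d x y|].
  by rewrite !scalefunE (bopD _ _ bT) (bopZ _ _ bT) scalerDr !scalerA mulrC.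
have nc : (complex.Re `|c|)%:C = `|c| by rewrite RRe_real // normr_real.
have c0 : 0 <= complex.Re `|c| by rewrite -ler0c nc.
exists (complex.Re `|c| * C) => [|x]; first by rewrite mulr_ge0 // ltW.
rewrite scalefunE -lecR -rnormE normrZ -mulrA. 
rewrite rmorphM /= nc rnormE.
by apply: ler_wpM2l; rewrite ?normr_ge0 // lecR.
Qed.

(** Polarization: <A z, z> is real for z = x, y and x + i y, and the imaginary part of the last one
    equals Re <A y, x> - Re <A x, y>. *)
Lemma positive_symmetric A x y :
  positive_operator A -> rinner (A x) y = rinner x (A y).
Proof.
move=> [bA posA]; have imA z : complex.Im (inner (A z) z) = 0.
  exact: ger0_Im.
have := imA (x + 'i *: y); rewrite bopD // bopZ // !(innerDl, innerDr) !(innerZl, innerZr).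
have := imA x; have := imA y; rewrite (rinnerC x) /rinner.
case: (inner (A x) x) => ? ? /= ; case: (inner (A y) y) => ? ? /=.
case: (inner (A x) y) => ? ? /= ; case: (inner (A y) x) => ? ? /=.
move=> -> ->; lra.
Qed.

End BoundedOperators.

(** * Riesz representation and existence of the adjoint *)

Section Adjoint.
Context {R : realType} {H : hilbertType R}.
Implicit Types (S T : H -> H) (x y z w : H).

(* [f] is represented by the minimizer of [x |-> |x|^2 - 2 f x]: by the
   parallelogram law the approximate minimizers form a Cauchy filter. *)
Lemma riesz_representation (f : H -> R) (C : R) :
  {morph f : x y / x + y} -> (forall a x, f (a%:C *: x) = a * f x) ->
  (forall x, f x <= C * rnorm x) ->
  exists z, forall x, f x = rinner x z.
Proof.
move=> fD fZ fC; pose phi x := rnorm x ^+ 2 - 2 * f x.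
have phi_lb x : - C ^+ 2 <= phi x.
  rewrite /phi; have := fC x; have := sqr_ge0 (rnorm x - C).
  rewrite sqrrB; lra.
pose m := inf (range phi).
have phi_inf : has_inf (range phi).
  split; first by exists (phi 0); exists 0.
  by exists (- C ^+ 2) => _ [x _ <-].
have m_le x : m <= phi x by apply: ge_inf; [case: phi_inf | exists x].
have approx (e : R) : 0 < e -> exists x, phi x < m + e.
  by move=> /inf_adherent/(_ phi_inf)[_ [x _ <-] ?]; exists x.
(* Parallelogram law, with [m] as a lower bound for [phi] at the midpoint of x and y. *)
have close x y : rnorm (x - y) ^+ 2 <= 2 * phi x + 2 * phi y - 4 * m.
  have := m_le ((2^-1)%:C *: (x + y)).
  rewrite /phi fZ fD rnormZ ?invr_ge0 // exprMn rnormB2 rnormD2; lra.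
pose F := filter_from [set e : R | 0 < e] (fun e => [set x | phi x < m + e]).
have FF : ProperFilter F.
  apply: filter_from_proper => [|e /approx//].
  apply: filter_from_filter => [|e d e0 d0]; first by exists 1 => /=.
  exists (Order.min e d) => [|x /= xed]; first by rewrite /= lt_min e0.
  by split; apply: lt_le_trans xed _; rewrite lerD2l ge_min lexx ?orbT.
have /cauchy_cvg Fcvg : cauchy F.
  apply: cauchy_exP => e e0.
  have [d de] : exists d : R, e = d%:C.
    by apply/complex_realP; rewrite gtr0_real.
  have d0 : 0 < d by rewrite -ltcR -de.
  (* Two points with [phi] below m + c have squared distance below 4 c = d^2 / 2 by [close]. *)
  pose c : R := d ^+ 2 / 8.
  have c0 : 0 < c by rewrite divr_gt0 // exprn_gt0.
  have [x xc] := approx c c0.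
  exists x; exists c => // y /= yc.
  rewrite -ball_normE /= rnormE de ltcR.
  rewrite -(ltr_pXn2r (_ : 0 < 2)%N) ?nnegrE ?rnorm_ge0 ?(ltW d0) //.
  have dd : 0 < d ^+ 2 by rewrite exprn_gt0.
  apply: le_lt_trans (close x y) _; rewrite /c in xc yc; lra.
have [z Fz] : exists z, F --> z by exists (lim F).
(* First-order optimality: compare [phi] at an approximate minimizer x near z with its value at x +
   d w, and let d be small. *)
have le_z w : f w <= rinner w z.
  apply/ler_addgt0Pr => e e0.
  (* The total error is d k: the first summand comes from comparing [phi] at x and x + d w, where x
     is minimal up to d^2, and the second from |x - z| < d. *)
  pose k := (1 + rnorm w ^+ 2) / 2 + rnorm w.
  have w0 := rnorm_ge0 w.
  have k0 : 0 < k.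
    by rewrite ltr_wpDr // divr_gt0 // ltr_pwDl // exprn_ge0.
  pose d := e / k; have d0 : 0 < d by rewrite divr_gt0.
  have dk : d * k = e by rewrite /d divfK // gt_eqF.
  have [b /= b0 bz] : F (ball z d%:C).
    by apply: Fz; apply: nbhsx_ballx; rewrite (ltcR 0).
  have [|x] := approx (Order.min b (d ^+ 2)); first by rewrite lt_min b0 exprn_gt0.
  move=> xbd; have /bz : phi x < m + b.
    by apply: lt_le_trans xbd _; rewrite lerD2l ge_min lexx.
  rewrite -ball_normE /= rnormE ltcR => zx.
  have xd : phi x < m + d ^+ 2.
    by apply: lt_le_trans xbd _; rewrite lerD2l ge_min lexx orbT.
  have := m_le (x + d%:C *: w).
  rewrite /phi fD fZ rnormD2 rinnerZr rnormZ ?(ltW d0) // exprMn => mx.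
  have fx : 2 * (f w - rinner x w) <= d * (1 + rnorm w ^+ 2).
    rewrite -(ler_pM2l d0); rewrite /phi in xd; lra.
  have := rinner_le w (x - z).
  rewrite rinnerDr rinnerNr -(rnormN (x - z)) opprB (rinnerC w x) => xz.
  have : rnorm w * rnorm (z - x) <= rnorm w * d by rewrite ler_wpM2l // ltW.
  rewrite -dk /k; lra.
exists z => x; apply/eqP; rewrite eq_le le_z /=.
(* The reverse inequality is [le_z] at the opposite vector. *)
have := le_z ((-1)%:C *: x); rewrite fZ rinnerZl; lra.
Qed.

Lemma rinner_inj y z : (forall x, rinner x y = rinner x z) -> y = z.
Proof.
move=> yz; apply/eqP; rewrite -subr_eq0; apply/eqP/rnorm_eq0/eqP.
by rewrite -sqrf_eq0 -rinnerxx rinnerDr rinnerNr yz subrr.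
Qed.

Lemma rinner_ir x y : rinner x ('i *: y) = - rinner ('i *: x) y.
Proof.
by rewrite -[LHS]rinnerii scalerA -[_ * _]/('i ^+ 2) sqr_i scaleN1r rinnerNr.
Qed.

(** For each y, Riesz represents the real functional x |-> Re <T x, y>. Applying the resulting
    identity at i x as well recovers the complex inner product through [innerE]. *)
Lemma adjoint_exists T : bounded_operator T ->
  exists S, bounded_operator S /\ forall x y, inner (T x) y = inner x (S y).
Proof.
move=> bT; have [C C0 hC] := bounded_bound bT.
have /choice[S hS] : forall y, exists z, forall x, rinner (T x) y = rinner x z.
  move=> y; apply: (@riesz_representation _ (C * rnorm y)).
  - by move=> u v /=; rewrite bopD // rinnerDl.
  - by move=> a u /=; rewrite bopZ // rinnerZl.
  - move=> u /=; rewrite (le_trans (rinner_le _ _)) // mulrAC.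
    by rewrite ler_wpM2r // rnorm_ge0.
have innerS x y : inner (T x) y = inner x (S y).
  by rewrite !innerE hS !rinner_ir -bopZ // hS.
exists S; split=> //; apply/bounded_operatorP; split.
  move=> c y z; apply: rinner_inj => x.
  by rewrite /rinner -innerS !innerDr !innerZr !innerS.
exists C => [|y]; first exact: ltW.
(* The bound comes from |S y|^2 = Re <T (S y), y> <= C |S y| |y|, divided by |S y|. *)
have [->|Sy0] := eqVneq (rnorm (S y)) 0.
  by rewrite mulr_ge0 ?rnorm_ge0 // ltW.
rewrite -(ler_pM2l (_ : 0 < rnorm (S y))) ?lt_neqAle ?rnorm_ge0 1?eq_sym ?Sy0 //.
rewrite -expr2 -rinnerxx -hS (le_trans (rinner_le _ _)) // mulrCA mulrA.
by rewrite ler_wpM2r ?rnorm_ge0 // hC.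
Qed.

Lemma adjointP T : bounded_operator T ->
  bounded_operator (adjoint T) /\
  forall x y, inner (T x) y = inner x (adjoint T y).
Proof. by move=> /adjoint_exists/(xgetPex 0). Qed.

End Adjoint.

(** * The operator norm and vectors that almost attain it *)

Section OperatorNorm.
Context {R : realType} {H : hilbertType R}.
Implicit Types (S T A B X Y : H -> H) (x y v : H).

Lemma opnorm_has_sup T : bounded_operator T ->
  has_sup [set complex.Re `|T x| | x in [set x : H | `|x| <= 1]].
Proof.
move=> bT; have [C C0 hC] := bounded_bound bT.
split; first by exists (complex.Re `|T 0|); exists 0 => //=; rewrite normr0 ler01.
exists C => _ [x /= x1 <-]; rewrite -/(rnorm (T x)) (le_trans (hC x)) //.
by rewrite ler_piMr ?(ltW C0) // -lecR -rnormE.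
Qed.

Lemma opnorm_ball T x : bounded_operator T -> rnorm x <= 1 ->
  rnorm (T x) <= opnorm T.
Proof.
move=> bT x1; apply: sup_ubound; first by case: (opnorm_has_sup bT).
by exists x => //=; rewrite rnormE lecR.
Qed.

Lemma opnorm_ge0 T : bounded_operator T -> 0 <= opnorm T.
Proof.
by move=> bT; rewrite (le_trans _ (opnorm_ball bT (_ : rnorm 0 <= 1))) ?rnorm_ge0 ?rnorm0.
Qed.

Lemma opnorm_bound T x : bounded_operator T ->
  rnorm (T x) <= opnorm T * rnorm x.
Proof.
move=> bT; have [x0|x0] := eqVneq (rnorm x) 0.
  by rewrite (rnorm_eq0 x0) (bop0 bT) rnorm0 mulr0.
have xp : 0 < rnorm x by rewrite lt_neqAle eq_sym x0 rnorm_ge0.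
have := @opnorm_ball T ((rnorm x)^-1%:C *: x) bT.
rewrite (bopZ _ _ bT) !rnormZ ?invr_ge0 ?(ltW xp) // mulVf // lexx => /(_ isT).
by rewrite mulrC ler_pdivrMr.
Qed.

Lemma opnorm_le T (C : R) : (forall x, rnorm x <= 1 -> rnorm (T x) <= C) ->
  opnorm T <= C.
Proof.
move=> hC; apply: ge_sup.
  by exists (complex.Re `|T 0|); exists 0 => //=; rewrite normr0 ler01.
by move=> _ [x /= x1 <-]; apply: hC; rewrite -lecR -rnormE.
Qed.

Lemma opnorm_adherent T (e : R) : bounded_operator T -> 0 < e ->
  exists2 x, rnorm x <= 1 & opnorm T - e < rnorm (T x).
Proof.
move=> bT e0; have [_ [x /= x1 <-] xe] := sup_adherent e0 (opnorm_has_sup bT).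
by exists x => //; rewrite -lecR -rnormE.
Qed.

(** Normalizing a nonzero near-maximizer of the unit ball does not decrease |T x|. If the
    near-maximizer is 0, then [opnorm T - e] is negative and any nonzero vector will do. *)
Lemma opnorm_adherent_unit T (e : R) : (exists x : H, x != 0) ->
  bounded_operator T -> 0 < e ->
  exists2 x, rnorm x = 1 & opnorm T - e < rnorm (T x).
Proof.
move=> [z z0] bT e0; have [x x1 xe] := opnorm_adherent bT e0.
have [y [y0 y1]] : exists y, 0 < rnorm y /\ opnorm T - e < rnorm (T y) / rnorm y.
  have [x0|x0] := eqVneq (rnorm x) 0.
    exists z; have zp : 0 < rnorm z.
      rewrite lt_neqAle eq_sym rnorm_ge0 andbT.
      by apply: contra_neq z0 => /rnorm_eq0.
    split=> //; rewrite (lt_le_trans xe) //.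
    by rewrite (rnorm_eq0 x0) (bop0 bT) rnorm0 divr_ge0 ?rnorm_ge0 // ltW.
  have xp : 0 < rnorm x by rewrite lt_neqAle eq_sym x0 rnorm_ge0.
  exists x; split=> //; rewrite (lt_le_trans xe) // ler_pdivlMr //.
  by rewrite ler_piMr // rnorm_ge0.
exists ((rnorm y)^-1%:C *: y).
  by rewrite rnormZ ?invr_ge0 ?(ltW y0) // mulVf // gt_eqF.
by rewrite (bopZ _ _ bT) rnormZ ?invr_ge0 ?(ltW y0) // mulrC.
Qed.

End OperatorNorm.

(** * The Heinz inequality for bounded operators *)

Section Heinz.
Context {R : realType} {H : hilbertType R}.
Implicit Types (S T A B X Y : H -> H) (x y v : H).

Lemma rinner_adjoint T x y : bounded_operator T ->
  rinner (T x) y = rinner x (adjoint T y).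
Proof. by move=> /adjointP[_ hT]; rewrite /rinner hT. Qed.

Lemma rnorm_adjoint_le T x : bounded_operator T ->
  rnorm (adjoint T x) <= opnorm T * rnorm x.
Proof.
move=> bT; have [->|x0] := eqVneq (rnorm (adjoint T x)) 0.
  by rewrite mulr_ge0 ?rnorm_ge0 ?opnorm_ge0.
rewrite -(ler_pM2l (_ : 0 < rnorm (adjoint T x))) ?lt_neqAle ?rnorm_ge0 1?eq_sym ?x0 //.
rewrite -expr2 -rinnerxx -rinner_adjoint // (le_trans (rinner_le _ _)) //.
by rewrite mulrCA mulrA ler_wpM2r ?rnorm_ge0 // opnorm_bound.
Qed.

(** With L the norm of T, expand the square: its terms are |T^* T v|^2 <= L^2 |T v|^2, the cross
    term -2 L^2 |T v|^2, and L^4 |v|^2 <= L^4. Near-maximizers of |T v| are thus approximate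
    eigenvectors of T^* T. *)
Lemma adjoint_comp_defect T v : bounded_operator T -> rnorm v <= 1 ->
  rnorm (adjoint T (T v) - (opnorm T ^+ 2)%:C *: v) ^+ 2
    <= opnorm T ^+ 2 * (opnorm T ^+ 2 - rnorm (T v) ^+ 2).
Proof.
move=> bT v1; set L := opnorm T; have L0 : 0 <= L by exact: opnorm_ge0.
have := rnorm_adjoint_le (T v) bT; rewrite -/L.
rewrite -(ler_pXn2r (_ : 0 < 2)%N) ?nnegrE ?mulr_ge0 ?rnorm_ge0 // exprMn.
rewrite rnormB2 rinnerZr (rinnerC _ v) -rinner_adjoint // rinnerxx.
rewrite rnormZ ?exprn_ge0 // exprMn => h.
have : L ^+ 2 ^+ 2 * rnorm v ^+ 2 <= L ^+ 2 ^+ 2.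
  by rewrite ler_piMr ?exprn_ge0 // exprn_ile1 // rnorm_ge0.
lra.
Qed.

(* For [v] a unit vector at which [Y = A X B] almost attains its norm [L],
   [Y^* Y v] is close to [L^2 v].  With [p = A Y v] and [q = B v] the number
   [<(A A X + X B B) q, p>] is then close to
   [|p|^2 + L^2 |q|^2 >= 2 L |p| |q|], and [q] stays away from [0]. *)
Lemma heinz A B X :
  bounded_operator A -> bounded_operator B -> bounded_operator X ->
  (forall x y, rinner (A x) y = rinner x (A y)) ->
  (forall x y, rinner (B x) y = rinner x (B y)) ->
  2 * opnorm (A \o X \o B) <= opnorm ((A \o A \o X) + (X \o B \o B)).
Proof.
move=> bA bB bX sA sB.
have bY := bounded_comp (bounded_comp bA bX) bB.
have bZ := bounded_add (bounded_comp (bounded_comp bA bA) bX)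
  (bounded_comp (bounded_comp bX bB) bB).
set Y := A \o X \o B in bY *; set Z := _ + _ in bZ *.
set L := opnorm Y; set N := opnorm Z.
rewrite leNgt; apply/negP => NL.
have N0 : 0 <= N by exact: opnorm_ge0.
have L0 : 0 < L by lra.
have [c c0 hc] := bounded_bound (bounded_comp bA bX).
have [b b0 hb] := bounded_bound bB.
(* Constants of the estimate K <= D |r| proved in [h2], where r is the defect vector. *)
pose K := (2 * L - N) * L ^+ 4; pose D := 8 * c ^+ 2 * L * b ^+ 2.
have K0 : 0 < K by rewrite mulr_gt0 ?exprn_gt0 // subr_gt0.
have D0 : 0 < D by rewrite !mulr_gt0 ?exprn_gt0.
pose d := 4 * D ^+ 2 * L ^+ 3.
have d0 : 0 < d by rewrite !mulr_gt0 ?exprn_gt0.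
(* The bound L / 2 keeps |Y v| above L / 2, hence q away from 0. The other bound gives D^2 |r|^2 <=
   d e / 2 <= K^2 / 2, which contradicts [h2]. *)
pose e := Order.min (L / 2) (K ^+ 2 / d).
have [|v v1 hv] := @opnorm_adherent _ _ Y e bY.
  by rewrite lt_min !divr_gt0 // exprn_gt0.
have eL : e <= L / 2 by rewrite /e ge_min lexx.
have eK : d * e <= K ^+ 2.
  by rewrite mulrC -ler_pdivlMr // /e ge_min lexx orbT.
set s := rnorm (Y v) in hv; rewrite -/L in hv.
have sL : s <= L by exact: opnorm_ball.
pose p := A (Y v); pose q := B v.
pose r := adjoint Y (Y v) - (L ^+ 2)%:C *: v.
have rE : rnorm r ^+ 2 <= 2 * L ^+ 3 * e.
  apply: le_trans (adjoint_comp_defect bY v1) _; rewrite -/L -/s.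
  rewrite (_ : 2 * L ^+ 3 * e = L ^+ 2 * (2 * L * e)); last by ring.
  rewrite ler_pM2l ?exprn_gt0 //.
  have : (L - s) * (L + s) <= e * (2 * L).
    apply: ler_pM; lra.
  lra.
have key : rnorm p ^+ 2 + L ^+ 2 * rnorm q ^+ 2 + rinner (B q) r
    <= N * rnorm q * rnorm p.
  have -> : rnorm p ^+ 2 + L ^+ 2 * rnorm q ^+ 2 + rinner (B q) r
      = rinner (Z q) p.
    (* Here A X q = Y v, so the first term is |p|^2. By symmetry of A the second is <Y (B q), Y v> =
       <B q, L^2 v + r>, and symmetry of B gives L^2 |q|^2. *)
    rewrite [Z q]addfunE rinnerDl /= -[A (X q)]/(Y v) -/p rinnerxx.
    rewrite {3}/p -sA -[A (X (B (B q)))]/(Y (B q)) (rinner_adjoint _ _ bY).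
    rewrite -addrA; congr (_ + _).
    rewrite /r rinnerDr rinnerNr rinnerZr (sB q v) -/q rinnerxx; ring.
  by rewrite (le_trans (rinner_le _ _)) // ler_wpM2r ?rnorm_ge0 // opnorm_bound.
have qb : rnorm (B q) <= b ^+ 2.
  rewrite (le_trans (hb _)) // expr2 ler_pM2l //.
  by rewrite (le_trans (hb _)) // ler_piMr // ltW.
have re : - (b ^+ 2 * rnorm r) <= rinner (B q) r.
  rewrite lerNl -rinnerNl (le_trans (rinner_le _ _)) // rnormN.
  by rewrite ler_wpM2r ?rnorm_ge0.
have Lq : L <= 2 * c * rnorm q.
  have := hc q; rewrite -[(A \o X) q]/(Y v) -/s; lra.
have q0 := rnorm_ge0 q; have r0 := rnorm_ge0 r.
(* Multiply [key] by 2 L and bound the mixed term through 2 L |p| |q| <= |p|^2 + L^2 |q|^2, weighted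
   by N; then drop (2 L - N) |p|^2 >= 0. *)
have h1 : (2 * L - N) * L ^+ 2 * rnorm q ^+ 2 <= 2 * L * b ^+ 2 * rnorm r.
  have : 0 <= N * (rnorm p - L * rnorm q) ^+ 2 by rewrite mulr_ge0 ?sqr_ge0.
  have : 0 <= (2 * L - N) * rnorm p ^+ 2 by rewrite mulr_ge0 ?sqr_ge0 // subr_ge0 ltW.
  have : 2 * L * (rnorm p ^+ 2 + L ^+ 2 * rnorm q ^+ 2 - b ^+ 2 * rnorm r)
      <= 2 * L * (N * rnorm q * rnorm p).
    by rewrite ler_pM2l ?mulr_gt0 //; lra.
  lra.
have h2 : K <= D * rnorm r.
  have Lq2 : L ^+ 2 <= 4 * c ^+ 2 * rnorm q ^+ 2.
    rewrite (_ : 4 * _ * _ = (2 * c * rnorm q) ^+ 2); last by ring.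
    by rewrite ler_pXn2r // ?nnegrE ?(ltW L0) // !mulr_ge0 // ltW.
  have : (2 * L - N) * L ^+ 2 * L ^+ 2
      <= (2 * L - N) * L ^+ 2 * (4 * c ^+ 2 * rnorm q ^+ 2).
    by rewrite ler_wpM2l // mulr_ge0 ?sqr_ge0 // subr_ge0 ltW.
  have : 4 * c ^+ 2 * ((2 * L - N) * L ^+ 2 * rnorm q ^+ 2)
      <= 4 * c ^+ 2 * (2 * L * b ^+ 2 * rnorm r).
    by rewrite ler_wpM2l // mulr_ge0 ?sqr_ge0.
  rewrite /K /D; lra.
have : K ^+ 2 <= D ^+ 2 * rnorm r ^+ 2.
  by rewrite -exprMn ler_pXn2r ?nnegrE ?(ltW K0) ?(mulr_ge0 (ltW D0) r0).
have : D ^+ 2 * rnorm r ^+ 2 <= D ^+ 2 * (2 * L ^+ 3 * e).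
  by rewrite ler_wpM2l // sqr_ge0.
have : 0 < K ^+ 2 by rewrite exprn_gt0.
rewrite /d in eK; lra.
Qed.

End Heinz.

(** * Maximal norm of a sum and the closed numerical range *)

Section NormEquality.
Context {R : realType} {H : hilbertType R}.
Implicit Types (S T A B X Y : H -> H) (x y v : H).

Lemma closure_numerical_range S (z : R[i]) :
  closure (numerical_range S) z <->
  forall e : R, 0 < e ->
    exists2 x, rnorm x = 1 & `|z - inner (S x) x| < e%:C.
Proof.
split=> [clz e e0|hz U].
  have /clz[_ [[x /= x1 <-]]] : nbhs (z : R[i]^o) (ball (z : R[i]^o) e%:C).
    by apply: nbhsx_ballx; rewrite (ltcR 0).
  rewrite -ball_normE /= => xe; exists x => //.
  by apply: complexI; rewrite -rnormE x1.
rewrite -nbhs_ballE => -[e /= e0 eU].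
have [d de] : exists d : R, e = d%:C.
  by apply/complex_realP; rewrite gtr0_real.
have d0 : 0 < d by rewrite -ltcR -de.
have [x x1 xd] := hz d d0.
exists (inner (S x) x); split; first by exists x => //=; rewrite rnormE x1.
by apply: eU; rewrite -ball_normE /= de.
Qed.

Lemma opnorm_eq_double A B (s r : R) : (exists x : H, x != 0) ->
  bounded_operator A -> bounded_operator B -> 0 < s -> 0 < r ->
  r * opnorm B <= s * opnorm A ->
  opnorm (s%:C *: A + r%:C *: B) = 2 * s * opnorm A <->
  closure (numerical_range (adjoint A \o B)) ((s / r * opnorm A ^+ 2)%:C).
Proof.
move=> H0 bA bB s0 r0 BA; set P := _ + _; set a := opnorm A in BA *.
have a0 : 0 <= a by exact: opnorm_ge0.
have bP : bounded_operator P by apply: bounded_add; exact: bounded_scale.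
have sr0 : 0 < s * r by exact: mulr_gt0.
have PE x : P x = s%:C *: A x + r%:C *: B x by [].
have normA x : rnorm x <= 1 -> s * rnorm (A x) <= s * a.
  by move=> x1; rewrite ler_pM2l // opnorm_ball.
have normB x : rnorm x <= 1 -> r * rnorm (B x) <= s * a.
  by move=> x1; rewrite (le_trans _ BA) // ler_pM2l // opnorm_ball.
have P_le x : rnorm x <= 1 -> rnorm (P x) <= 2 * s * a.
  move=> x1; rewrite PE (le_trans (rnormD _ _)) // !rnormZ ?(ltW s0) ?(ltW r0) //.
  by have := normA x x1; have := normB x x1; lra.
have P2 x : rnorm (P x) ^+ 2 = s ^+ 2 * rnorm (A x) ^+ 2
    + r ^+ 2 * rnorm (B x) ^+ 2 + 2 * (s * r * rinner (B x) (A x)).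
  rewrite PE rnormD2 !rnormZ ?(ltW s0) ?(ltW r0) // !exprMn.
  by rewrite rinnerZl rinnerZr (rinnerC (A x)) !mulrA.
have innerA x : inner ((adjoint A \o B) x) x = inner (B x) (A x).
  by have [_ hA] := adjointP bA; rewrite innerC -hA -innerC.
rewrite closure_numerical_range; set k := s * a in normA normB.
have k0 : 0 <= k by rewrite mulr_ge0 // ltW.
split=> [Pk e e0|near_k]; last first.
  apply/eqP; rewrite eq_le opnorm_le //=.
  rewrite -(ler_pXn2r (_ : 0 < 2)%N) ?nnegrE ?opnorm_ge0 ?mulr_ge0 ?(ltW s0) //.
  apply/ler_addgt0Pr => e e0.
  (* Chosen so that |P x|^2 >= 4 s r Re <B x, A x> > 4 (s a)^2 - e. *)
  pose d := e / (4 * (s * r)); have d0 : 0 < d by rewrite divr_gt0 // mulr_gt0.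
  have [x x1] := near_k d d0; rewrite innerA => xd.
  have : s / r * a ^+ 2 - d < rinner (B x) (A x).
    have := le_lt_trans (normc_ge_Re _) xd; rewrite ltcR Re_addc.
    rewrite -[complex.Re (- _)]/(complex.Re (- inner (B x) (A x))).
    have -> : complex.Re (- inner (B x) (A x)) = - rinner (B x) (A x).
      by rewrite /rinner; case: (inner _ _).
    by rewrite ltr_norml /=; lra.
  rewrite -(ltr_pM2l sr0) mulrBr.
  have -> : s * r * (s / r * a ^+ 2) = (s * a) ^+ 2.
    by field; rewrite gt_eqF.
  have -> : s * r * d = e / 4 by rewrite /d; field; rewrite !gt_eqF.
  move=> hx; have : rnorm (P x) ^+ 2 <= opnorm P ^+ 2.
    by rewrite ler_pXn2r ?nnegrE ?rnorm_ge0 ?opnorm_ge0 // opnorm_ball // x1.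
  rewrite P2.
  have : 0 <= rnorm (s%:C *: A x - r%:C *: B x) ^+ 2 by exact: sqr_ge0.
  rewrite rnormB2 !rnormZ ?(ltW s0) ?(ltW r0) // !exprMn.
  rewrite rinnerZl rinnerZr (rinnerC (A x)); lra.
(* The final error is 4 k^3 d, which must stay below (s r e)^2; the [+ 1] keeps the denominator
   positive when k = 0. *)
pose d := (s * r * e) ^+ 2 / (8 * k ^+ 3 + 1).
have k3 : 0 < 8 * k ^+ 3 + 1 by rewrite ltr_wpDl // mulr_ge0 // exprn_ge0.
have sre : 0 < (s * r * e) ^+ 2 by rewrite exprn_gt0 // mulr_gt0.
have d0 : 0 < d by rewrite divr_gt0.
have [x x1] := opnorm_adherent_unit H0 bP d0; rewrite Pk => xd.
have x1' : rnorm x <= 1 by rewrite x1.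
exists x => //; rewrite innerA.
set w := inner (B x) (A x).
have nw2 : complex.Re w ^+ 2 + complex.Im w ^+ 2
    <= (rnorm (B x) * rnorm (A x)) ^+ 2.
  rewrite -lecR add_Re2_Im2 rmorphXn.
  have le_w := inner_le (B x) (A x).
  by apply: lerXn2r (le_w); rewrite nnegrE // (le_trans _ le_w).
have Ak := normA x x1'; have Bk := normB x x1'.
have A0 := rnorm_ge0 (A x); have B0 := rnorm_ge0 (B x).
have sA0 : 0 <= s * rnorm (A x) by rewrite mulr_ge0 // ltW.
have rB0 : 0 <= r * rnorm (B x) by rewrite mulr_ge0 // ltW.
have sr_w : (s * r) ^+ 2 * (complex.Re w ^+ 2 + complex.Im w ^+ 2) <= k ^+ 4.
  apply: (@le_trans _ _ ((s * r) ^+ 2 * (rnorm (B x) * rnorm (A x)) ^+ 2)).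
    by rewrite ler_pM2l // exprn_gt0.
  rewrite -exprMn.
  have -> : s * r * (rnorm (B x) * rnorm (A x))
      = (s * rnorm (A x)) * (r * rnorm (B x)) by ring.
  have AB : s * rnorm (A x) * (r * rnorm (B x)) <= k ^+ 2.
    by rewrite expr2 ler_pM.
  by rewrite (exprM k 2 2) lerXn2r ?nnegrE ?(mulr_ge0 sA0 rB0) ?exprn_ge0.
have Re_w : k ^+ 2 - 2 * k * d <= s * r * complex.Re w.
  have := P2 x; rewrite -[rinner _ _]/(complex.Re w) => P2x.
  have : s ^+ 2 * rnorm (A x) ^+ 2 <= k ^+ 2.
    by rewrite -exprMn; apply: lerXn2r.
  have : r ^+ 2 * rnorm (B x) ^+ 2 <= k ^+ 2.
    by rewrite -exprMn; apply: lerXn2r.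
  (* A product replaces squaring 2 k - d < |P x|, since 2 k - d may be negative; with |P x| <= 2 k
     it gives |P x|^2 >= 4 k^2 - 4 k d. *)
  have : 0 <= (rnorm (P x) - (2 * k - d)) * (2 * k + rnorm (P x)).
    apply: mulr_ge0; first by rewrite subr_ge0 ltW // /k mulrA.
    by have := rnorm_ge0 (P x); lra.
  have : d * rnorm (P x) <= d * (2 * k).
    by rewrite ler_pM2l // /k mulrA P_le.
  lra.
have -> : s / r * a ^+ 2 = k ^+ 2 / (s * r).
  by rewrite /k; field; rewrite !gt_eqF.
rewrite -[`|_|]ger0_norm ?normr_ge0 //.
rewrite normc_def ger0_norm ?ltcR; last by rewrite ler0c sqrtr_ge0.
have -> : e = Num.sqrt (e ^+ 2) by rewrite sqrtr_sqr ger0_norm // ltW.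
rewrite ltr_sqrt ?exprn_gt0 //.
rewrite -(ltr_pM2l (exprn_gt0 2 sr0)).
have -> : (s * r) ^+ 2 * e ^+ 2 = d * (8 * k ^+ 3 + 1).
  by rewrite /d divfK ?gt_eqF // -exprMn.
have kk : s * r * (k ^+ 2 / (s * r)) = k ^+ 2 by field; rewrite !gt_eqF.
case: w sr_w Re_w {nw2} => u v /= sr_w Re_w.
(* Scaled by s r, the squared distance is k^4 + |s r w|^2 - 2 k^2 Re (s r w), where w = u + i v. By
   [sr_w] and [Re_w] this is at most 4 k^3 d. *)
have -> : (s * r) ^+ 2 * ((k ^+ 2 / (s * r) - u) ^+ 2 + (0 - v) ^+ 2)
  = k ^+ 4 + (s * r) ^+ 2 * (u ^+ 2 + v ^+ 2) - 2 * k ^+ 2 * (s * r * u).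
  by field; rewrite !gt_eqF.
have : 2 * k ^+ 2 * (k ^+ 2 - 2 * k * d) <= 2 * k ^+ 2 * (s * r * u).
  by rewrite ler_wpM2l // mulr_ge0 // sqr_ge0.
have : 0 <= d * k ^+ 3 by rewrite mulr_ge0 ?exprn_ge0 // ltW.
lra.
Qed.

End NormEquality.

(** * Application to the Duggal, Aluthge and mean transforms *)

Section Transforms.
Context {R : realType} {H : hilbertType R}.
Implicit Types (S T A : H -> H) (x y : H).

Lemma opnorm_scale T (a : R) : bounded_operator T -> 0 < a ->
  opnorm (a%:C *: T) = a * opnorm T.
Proof.
move=> bT a0; have baT := bounded_scale a%:C bT.
have aT x : rnorm ((a%:C *: T) x) = a * rnorm (T x) by rewrite scalefunE rnormZ ?ltW.
apply/eqP; rewrite eq_le; apply/andP; split.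
  by apply: opnorm_le => x x1; rewrite aT ler_pM2l // opnorm_ball.
rewrite -ler_pdivlMl //; apply: opnorm_le => x x1.
by rewrite ler_pdivlMl // -aT opnorm_ball.
Qed.

(** [xget] returns a genuine positive square root or the default 0; since 0 is itself positive, only
    the squaring identity splits into cases. *)
Lemma opsqrtP A : positive_operator (opsqrt A) /\
  (opsqrt A = 0 \/ opsqrt A \o opsqrt A = A).
Proof.
have [exS|no] := pselect (exists S, positive_operator S /\ S \o S = A).
  by have /(xgetPex 0)[] := exS; split=> //; right.
have -> : opsqrt A = 0 by apply: xgetPN => S hS; apply: no; exists S.
split; last by left.
split=> [|x]; first exact: bounded_zero.
by rewrite linear0l.
Qed.

Lemma polar_factorP T : bounded_operator (polar_factor T) /\
  (polar_factor T = 0 \/ T = polar_factor T \o opabs T).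
Proof.
have [exU|no] := pselect (exists U, [/\ partial_isometry U,
    T = U \o opabs T & nullspace U = nullspace T]).
  by have /(xgetPex 0)[[bU _] TU _] := exU; split=> //; right.
have -> : polar_factor T = 0 by apply: xgetPN => U hU; apply: no; exists U.
by split; [exact: bounded_zero|left].
Qed.

Lemma bounded_duggal T : bounded_operator (duggal T).
Proof.
have [[bP _] _] := opsqrtP (adjoint T \o T); have [bU _] := polar_factorP T.
exact: bounded_comp bP bU.
Qed.

Lemma bounded_aluthge T : bounded_operator (aluthge T).
Proof.
have [[bQ _] _] := opsqrtP (opabs T); have [bU _] := polar_factorP T.
exact: bounded_comp (bounded_comp bQ bU) bQ.
Qed.

(* If a square root or the polar factor fell back to its default value [0],
   the Aluthge transform would vanish, so their existence is not needed. *)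
Lemma aluthge_le T (a b : R) : bounded_operator T -> 0 < a -> 0 < b ->
  2 * a * b * opnorm (aluthge T)
    <= opnorm ((a ^+ 2)%:C *: T + (b ^+ 2)%:C *: duggal T).
Proof.
move=> bT a0 b0; have bD := bounded_duggal T; have bE := bounded_aluthge T.
have rhs0 := opnorm_ge0 (bounded_add (bounded_scale (a ^+ 2)%:C bT)
  (bounded_scale (b ^+ 2)%:C bD)).
have aluthge0 : (forall x, aluthge T x = 0) ->
    2 * a * b * opnorm (aluthge T)
      <= opnorm ((a ^+ 2)%:C *: T + (b ^+ 2)%:C *: duggal T).
  move=> T0; apply: le_trans rhs0; rewrite pmulr_rle0 ?mulr_gt0 //.
  by apply: opnorm_le => x _; rewrite T0 rnorm0.
have [bU [U0|TU]] := polar_factorP T.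
  by apply: aluthge0 => x; rewrite /aluthge U0 /= bop0 //; case: (opsqrtP (opabs T)) => -[].
have [posQ [Q0|QQ]] := opsqrtP (opabs T); first by apply: aluthge0 => x; rewrite /aluthge Q0.
have bQ := posQ.1; set Q := opsqrt (opabs T) in posQ QQ bQ.
set U := polar_factor T in bU TU.
have sQ c x y : rinner ((c%:C *: Q) x) y = rinner x ((c%:C *: Q) y).
  by rewrite !scalefunE rinnerZl rinnerZr positive_symmetric.
(* The left factor carries b because its square yields b^2 |T| U, the Duggal term; the right one
   yields a^2 U |T| = a^2 T. *)
have := heinz (bounded_scale b%:C bQ) (bounded_scale a%:C bQ) bU (sQ b) (sQ a).
have -> : (b%:C *: Q) \o U \o (a%:C *: Q) = (a * b)%:C *: aluthge T.
  apply/funext => x; rewrite /= !scalefunE (bopZ _ _ bU) (bopZ _ _ bQ) scalerA.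
  by rewrite mulrC rmorphM.
rewrite opnorm_scale ?mulr_gt0 // !mulrA.
have -> // : ((b%:C *: Q) \o (b%:C *: Q) \o U) + (U \o (a%:C *: Q) \o (a%:C *: Q))
  = (a ^+ 2)%:C *: T + (b ^+ 2)%:C *: duggal T.
apply/funext => x; rewrite !addfunE /= !scalefunE !(bopZ _ _ bU) !(bopZ _ _ bQ).
rewrite !(bopZ _ _ bU) !scalerA -!expr2 -!rmorphXn /= addrC.
rewrite -[Q (Q (U x))]/((Q \o Q) (U x)) -[Q (Q x)]/((Q \o Q) x) QQ.
by rewrite -[U (opabs T x)]/((U \o opabs T) x) -TU.
Qed.

(** The weight of M is (1 - l)^2 / s, so s M is exactly the part of the power mean in T and its
    Duggal transform. The domination required by [opnorm_eq_double] is [aluthge_le] with a = 1 - l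
    and b = l. *)
Lemma power_mean_norm_eq (H_nonzero : exists x : H, x != 0) T (l : R) :
  bounded_operator T -> 0 < l < 1 ->
  let M := weighted_mean ((1 - l) ^+ 2 / ((1 - l) ^+ 2 + l ^+ 2)) T in
  opnorm (power_mean l T) = 2 * (1 - 2 * l + 2 * l ^+ 2) * opnorm M <->
  closure (numerical_range (adjoint M \o aluthge T))
    (((1 - 2 * l + 2 * l ^+ 2) / (2 * l - 2 * l ^+ 2) * opnorm M ^+ 2)%:C).
Proof.
move=> bT /andP[l0 l1] M; pose s := 1 - 2 * l + 2 * l ^+ 2.
pose r := 2 * l - 2 * l ^+ 2.
have l1' : 0 < 1 - l by rewrite subr_gt0.
have sE : (1 - l) ^+ 2 + l ^+ 2 = s by rewrite /s; ring.
have rE : 2 * l * (1 - l) = r by rewrite /r; ring.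
have s0 : 0 < s by rewrite -sE addr_gt0 ?exprn_gt0.
have r0 : 0 < r by rewrite -rE !mulr_gt0.
have bD := bounded_duggal T.
have bM : bounded_operator M.
  by apply: bounded_add; exact: bounded_scale.
have sM : s%:C *: M = ((1 - l) ^+ 2)%:C *: T + (l ^+ 2)%:C *: duggal T.
  rewrite /M /weighted_mean sE scalerDr !scalerA -!rmorphM /=.
  congr (_%:C *: _ + _%:C *: _); first by rewrite mulrC divfK ?gt_eqF.
  by rewrite -sE in s0 *; field; rewrite gt_eqF.
have PE : power_mean l T = s%:C *: M + r%:C *: aluthge T.
  by rewrite sM /power_mean rE.
rewrite PE -/s -/r; apply: opnorm_eq_double => //; first exact: bounded_aluthge.
rewrite -(opnorm_scale bM s0) sM -rE (mulrAC 2 l).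
exact: aluthge_le.
Qed.

End Transforms.

Theorem corollary2p24 (R : realType) (H : hilbertType R)
    (H_nonzero : exists x : H, x != 0)
    (T : H -> H) (T_bounded : bounded_operator T) :
  (forall lambda : R, 0 < lambda < 1 ->
    let M := weighted_mean
      ((1 - lambda) ^+ 2 / ((1 - lambda) ^+ 2 + lambda ^+ 2)) T in
    opnorm (power_mean lambda T)
      = 2 * (1 - 2 * lambda + 2 * lambda ^+ 2) * opnorm M
    <->
    closure (numerical_range (adjoint M \o aluthge T))
      (((1 - 2 * lambda + 2 * lambda ^+ 2) / (2 * lambda - 2 * lambda ^+ 2)
         * opnorm M ^+ 2)%:C))
  /\
  (opnorm (power_mean_transform T) = opnorm (mean_transform T)
   <->
   closure (numerical_range (adjoint (mean_transform T) \o aluthge T))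
     ((opnorm (mean_transform T) ^+ 2)%:C)).
Proof.
split=> [l l01|]; first exact: power_mean_norm_eq.
have half01 : 0 < (1 / 2 : R) < 1 by apply/andP; split; lra.
have := power_mean_norm_eq H_nonzero T_bounded half01.
rewrite /power_mean_transform /mean_transform.
(* At l = 1/2 one has s = r = 1/2, so M has weight 1/2 and both constants 2 s and s / r become 1. *)
have -> : (1 - 1 / 2) ^+ 2 / ((1 - 1 / 2) ^+ 2 + (1 / 2) ^+ 2) = 1 / 2 :> R.
  by field.
have -> : 2 * (1 - 2 * (1 / 2) + 2 * (1 / 2) ^+ 2) = 1 :> R by field.
have -> : (1 - 2 * (1 / 2) + 2 * (1 / 2) ^+ 2)
    / (2 * (1 / 2) - 2 * (1 / 2) ^+ 2) = 1 :> R by field.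
by rewrite !mul1r.
Qed.
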